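(* Let $\lambda\in\mathbb C^*$, $\alpha\in\mathbb C$, $h(t)\in\mathbb C[t]$. The set $\{\mathcal S_{sf},\ \mathcal S_{f}\mid f=f(t)\in\mathbb C[t]\}$ exhausts all $W(0,0)$-submodules of $\Phi(\lambda,\alpha,h)$ (that is, every $W(0,0)$-submodule of $\Phi(\lambda,\alpha,h)$ equals $\mathcal S_{sf}$ or $\mathcal S_f$ for some $f\in\mathbb C[t]$). In particular, all $W(0,0)$-submodules of $\Phi(\lambda,\alpha,h)$ are cyclic.
   Context: $W(0,0)$ is the complex Lie algebra with basis $\{L_m,W_m\mid m\in\mathbb Z\}$ and brackets $[L_m,L_n]=(n-m)L_{m+n}$, $[L_m,W_n]=nW_{m+n}$, $[W_m,W_n]=0$. For $\lambda\in\mathbb C^*$, $\alpha\in\mathbb C$, $h=h(t)\in\mathbb C[t]$, the $W(0,0)$-module $\Phi(\lambda,\alpha,h)$ is the polynomial space $\mathbb C[s,t]$ with action $$L_mf(s,t)=\lambda^m\big(s+mh(t)\big)f(s-m,t),\qquad W_mf(s,t)=\lambda^m t f(s-m,t)$$ for $m\in\mathbb Z$, $f(s,t)\in\mathbb C[s,t]$. (For this algebra the action does not depend on $\alpha$.) For $f(s,t)\in\mathbb C[s,t]$, $\mathcal S_{f(s,t)}$ denotes the $W(0,0)$-submodule of $\Phi(\lambda,\alpha,h)$ generated by $f(s,t)$; in particular $\mathcal S_{sf}$ is generated by $sf(t)$ and $\mathcal S_f$ by $f(t)$. *)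

(* Defs.v *)
From HB Require Import structures.
From mathcomp Require Import all_boot all_order all_algebra.
From mathcomp Require Import finmap monalg ring.
From mathcomp Require Import classical_sets reals complex.

Set Implicit Arguments.
Unset Strict Implicit.
Unset Printing Implicit Defensive.

Import Order.TTheory GRing.Theory Num.Theory.
Local Open Scope ring_scope.

Record lieAlgebra (K : fieldType) := LieAlgebra {
  lie_sort :> lmodType K;
  bracket : lie_sort -> lie_sort -> lie_sort;
  bracket_linearl : forall y, linear (bracket^~ y);
  bracket_linearr : forall x, linear (bracket x);
  bracket_alt : forall x, bracket x x = 0;
  bracket_jacobi : forall x y z,
    bracket x (bracket y z) + bracket y (bracket z x) + bracket z (bracket x y)
      = 0
}.

Record lieModule (K : fieldType) (g : lieAlgebra K) := LieModule {
  module_sort :> lmodType K;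
  act : g -> module_sort -> module_sort;
  act_linearl : forall v, linear (act^~ v);
  act_linearr : forall x, linear (act x);
  act_bracket : forall x y v,
    act (bracket x y) v = act x (act y v) - act y (act x v)
}.

Section Submodules.
Variables (K : fieldType) (g : lieAlgebra K) (V : lieModule g).

Definition submodule (N : set V) : Prop :=
  [/\ N 0,
      forall (c : K) u v, N u -> N v -> N (c *: u + v)
    & forall (x : g) v, N v -> N (act x v)].

Definition generated (v : V) : set V := smallest submodule [set v]%classic.

Definition cyclic_submodule (N : set V) : Prop := exists v, N = generated v.

Lemma generatedP (v : V) : submodule (generated v).
Proof.
split=> [N [[]]//|c x y Nx Ny N [sN vN]|x y Ny N [sN vN]].
  by case: (sN) => _ lN _; apply: lN; [exact: Nx|exact: Ny].
by case: (sN) => _ _ aN; apply: aN; exact: Ny.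
Qed.

End Submodules.

(* {malg K[I]} is the K-vector space with basis (<< i >>)_(i : I). *)
Section LinearExtension.
Variables (K : fieldType) (I : choiceType).
Implicit Types V W : lmodType K.

Definition linext V (phi : I -> V) (u : {malg K[I]}) : V :=
  \sum_(i <- msupp u) u@_i *: phi i.

Lemma linextEw V (phi : I -> V) (u : {malg K[I]}) (D : {fset I}) :
  (msupp u `<=` D)%fset -> linext phi u = \sum_(i <- D) u@_i *: phi i.
Proof.
move=> sD; rewrite /linext (big_fset_incl _ sD)// => i iD.
by rewrite -mcoeff_eq0 => /eqP ->; rewrite scale0r.
Qed.

Lemma linext_is_linear V (phi : I -> V) : linear (linext phi).
Proof.
move=> c u v.
pose D := (msupp u `|` msupp v `|` msupp (c *: u + v))%fset.
have uD : (msupp u `<=` D)%fset by rewrite /D -fsetUA fsubsetUl.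
have vD : (msupp v `<=` D)%fset.
  by rewrite /D [X in (X `|` _)%fset]fsetUC -fsetUA fsubsetUl.
have wD : (msupp (c *: u + v) `<=` D)%fset by rewrite /D fsubsetUr.
rewrite (linextEw _ uD) (linextEw _ vD) (linextEw _ wD) scaler_sumr -big_split.
by apply: eq_bigr => i _; rewrite mcoeffD mcoeffZ scalerDl scalerA.
Qed.

HB.instance Definition _ V (phi : I -> V) :=
  GRing.isLinear.Build K {malg K[I]} V *:%R (linext phi)
    (linext_is_linear phi).

Lemma linextU V (phi : I -> V) i : linext phi << i >> = phi i.
Proof.
have sD : (msupp (<< i >> : {malg K[I]}) `<=` [fset i])%fset.
  apply/fsubsetP => j; rewrite -mcoeff_neq0 mcoeffU inE (eq_sym j).
  by case: (i == j); rewrite ?mulr0n ?eqxx.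
by rewrite (linextEw _ sD) big_seq_fset1 mcoeffUU scale1r.
Qed.

Lemma malg_basis (u : {malg K[I]}) : u = \sum_(i <- msupp u) u@_i *: << i >>.
Proof.
rewrite [LHS]monalgE; apply: eq_bigr => i _; apply/malgP => j.
by rewrite mcoeffZ !mcoeffU mulrnAr mulr1.
Qed.

Lemma malg_ext V (f f' : {malg K[I]} -> V) : linear f -> linear f' ->
  (forall i, f << i >> = f' << i >>) -> f =1 f'.
Proof.
move=> lf lf' ff' u.
have E (e : {malg K[I]} -> V) : linear e ->
    e u = \sum_(i <- msupp u) u@_i *: e << i >>.
  move=> le; have e0 : e 0 = 0.
    by have /eqP := le (- 1) 0 0; rewrite scaler0 addr0 scaleN1r addNr => /eqP.
  rewrite {1}(malg_basis u); elim: (enum_fset _) => [|i s IHs].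
    by rewrite !big_nil.
  by rewrite !big_cons le IHs.
by rewrite (E _ lf) (E _ lf'); apply: eq_bigr => i _; rewrite ff'.
Qed.

Lemma linear_linextP V W (phi : I -> V -> W) (u : {malg K[I]}) :
  (forall i, linear (phi i)) -> linear (fun v => linext (phi^~ v) u).
Proof.
move=> lphi c v w; rewrite /linext scaler_sumr -big_split.
apply: eq_bigr => i _.
by rewrite lphi scalerDr !scalerA mulrC.
Qed.

End LinearExtension.

Section W00.
Variable K : numFieldType.

(* The basis: [inl m] indexes L_m and [inr m] indexes W_m. *)
Definition W00_index : choiceType := (int + int)%type.
Definition W00_space : lmodType K := {malg K[W00_index]}.

Definition Lgen (m : int) : W00_space := << inl m : W00_index >>.
Definition Wgen (m : int) : W00_space := << inr m : W00_index >>.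

Definition W00_basis_bracket (x y : W00_index) : W00_space :=
  match x, y with
  | inl m, inl n => (n - m)%:~R *: Lgen (m + n)
  | inl m, inr n => n%:~R *: Wgen (m + n)
  | inr m, inl n => - (m%:~R *: Wgen (n + m))
  | inr _, inr _ => 0
  end.

Definition W00_bracket (u v : W00_space) : W00_space :=
  linext (fun x => linext (W00_basis_bracket x) v) u.

Lemma W00_bracket_linearl v : linear (W00_bracket^~ v).
Proof. exact: linext_is_linear. Qed.

Lemma W00_bracket_linearr u : linear (W00_bracket u).
Proof. by apply: linear_linextP => x; exact: linext_is_linear. Qed.

Lemma W00_bracketE x y : W00_bracket << x >> << y >> = W00_basis_bracket x y.
Proof. by rewrite /W00_bracket !linextU. Qed.

Lemma W00_bracketC u v : W00_bracket u v = - W00_bracket v u.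
Proof.
move: u; apply: malg_ext; first exact: W00_bracket_linearl.
  by move=> c u w; rewrite W00_bracket_linearr opprD scalerN.
move=> x; move: v; apply: malg_ext; first exact: W00_bracket_linearr.
  by move=> c u w; rewrite W00_bracket_linearl opprD scalerN.
move=> y; rewrite !W00_bracketE.
case: x y => m [] n /=; rewrite ?opprK ?oppr0//.
by rewrite -scaleNr -mulrNz opprB (addrC n m).
Qed.

Lemma W00_bracket_alt u : W00_bracket u u = 0.
Proof.
apply/malgP => i; move: (W00_bracketC u u); move: (W00_bracket u u) => v vN.
have /eqP : v@_i = - v@_i by rewrite {1}vN mcoeffN.
by rewrite -addr_eq0 -mulr2n mulrn_eq0 mcoeff0 => /eqP.
Qed.

Let bracketZl c u v : W00_bracket (c *: u) v = c *: W00_bracket u v.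
Proof.
have := W00_bracket_linearl v c u 0; rewrite addr0 => ->.
by rewrite /W00_bracket linear0 addr0.
Qed.

Let bracketZr c u v : W00_bracket u (c *: v) = c *: W00_bracket u v.
Proof. by rewrite W00_bracketC bracketZl (W00_bracketC u) scalerN. Qed.

Let bracketNr u v : W00_bracket u (- v) = - W00_bracket u v.
Proof. by rewrite -scaleN1r bracketZr scaleN1r. Qed.

Let bracket0r u : W00_bracket u 0 = 0.
Proof. by have := bracketZr 0 u 0; rewrite !scale0r. Qed.

Lemma W00_bracketLL m n :
  W00_bracket (Lgen m) (Lgen n) = (n - m)%:~R *: Lgen (m + n).
Proof. exact: W00_bracketE. Qed.

Lemma W00_bracketLW m n :
  W00_bracket (Lgen m) (Wgen n) = n%:~R *: Wgen (m + n).
Proof. exact: W00_bracketE. Qed.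

Lemma W00_bracketWL m n :
  W00_bracket (Wgen m) (Lgen n) = - (m%:~R *: Wgen (n + m)).
Proof. exact: W00_bracketE. Qed.

Lemma W00_bracketWW m n : W00_bracket (Wgen m) (Wgen n) = 0.
Proof. exact: W00_bracketE. Qed.

Lemma W00_bracket_jacobi u v w :
  W00_bracket u (W00_bracket v w) + W00_bracket v (W00_bracket w u)
    + W00_bracket w (W00_bracket u v) = 0.
Proof.
have ll := W00_bracket_linearl; have lr := W00_bracket_linearr.
have addZ c (a b d a' b' d' : W00_space) :
    c *: a + a' + (c *: b + b') + (c *: d + d')
      = c *: (a + b + d) + (a' + b' + d').
  by apply/malgP => i; rewrite !(mcoeffD, mcoeffZ); ring.
have lin0 : linear (fun _ : W00_space => 0 : W00_space).
  by move=> c a b; rewrite scaler0 addr0.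
move: u; apply: malg_ext => // [c a b|x]; first by rewrite ll !(lr,ll) addZ.
move: v; apply: malg_ext => // [c a b|y]; first by rewrite !(lr,ll) addZ.
move: w; apply: malg_ext => // [c a b|z]; first by rewrite !(lr,ll) addZ.
have E := (W00_bracketLL, W00_bracketLW, W00_bracketWL, W00_bracketWW).
case: x y z => m [] n [] p; rewrite -?/(Lgen _) -?/(Wgen _);
  rewrite !E ?(bracketZr, bracketNr, bracket0r) ?E ?scaler0 ?oppr0
    ?addr0 ?add0r //.
all: have F : (m + (n + p) = m + n + p) * (n + (p + m) = m + n + p) *
  (p + (m + n) = m + n + p) * (n + (m + p) = m + n + p) *
  (m + (p + n) = m + n + p) * (p + (n + m) = m + n + p) *
  (p + m + n = m + n + p) * (n + p + m = m + n + p) by do !split; ring.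
all: rewrite !F; apply/malgP => i; rewrite !(mcoeffD, mcoeffN, mcoeffZ) mcoeff0.
all: ring.
Qed.

Definition W00 : lieAlgebra K :=
  LieAlgebra W00_bracket_linearl W00_bracket_linearr W00_bracket_alt
    W00_bracket_jacobi.

End W00.

(* C[s,t] is represented as C[t][s]: s is the outer variable and t the inner
   one. The alias carries the structure of vector space over K. *)
Definition poly_st (K : fieldType) := {poly {poly K}}.

Section PolySt.
Variable K : fieldType.

HB.instance Definition _ := GRing.ComNzRing.copy (poly_st K) {poly {poly K}}.

Definition scale_st (c : K) (f : poly_st K) : poly_st K :=
  c%:P *: (f : {poly {poly K}}).

Lemma scale_stA a b f : scale_st a (scale_st b f) = scale_st (a * b) f.
Proof. by rewrite /scale_st scalerA polyCM. Qed.

Lemma scale_st1 : left_id 1 scale_st.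
Proof. by move=> f; rewrite /scale_st scale1r. Qed.

Lemma scale_stDr : right_distributive scale_st +%R.
Proof. by move=> a f g; rewrite /scale_st scalerDr. Qed.

Lemma scale_stDl f : {morph scale_st^~ f : a b / a + b}.
Proof. by move=> a b; rewrite /scale_st polyCD scalerDl. Qed.

HB.instance Definition _ := GRing.Zmodule_isLmodule.Build K (poly_st K)
  scale_stA scale_st1 scale_stDr scale_stDl.

Definition var_s : poly_st K := 'X.
Definition var_t : poly_st K := 'X%:P.
Definition poly_t (f : {poly K}) : poly_st K := f%:P.
(* f(s,t) |-> f(s - m,t) *)
Definition shift_s (m : int) (f : poly_st K) : poly_st K :=
  f \Po (var_s - m%:~R).

Lemma scale_stE c (f : poly_st K) : c *: f = poly_t c%:P * f.
Proof. by rewrite /poly_t mul_polyC. Qed.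

Lemma shift_stD m f g : shift_s m (f + g) = shift_s m f + shift_s m g.
Proof. exact: comp_polyD. Qed.

Lemma shift_stM m f g : shift_s m (f * g) = shift_s m f * shift_s m g.
Proof. exact: comp_polyM. Qed.

Lemma shift_st_t m f : shift_s m (poly_t f) = poly_t f.
Proof. exact: comp_polyC. Qed.

Lemma shift_st_s m : shift_s m (var_s) = var_s - m%:~R.
Proof. exact: comp_polyX. Qed.

Lemma shift_st_int m k : shift_s m k%:~R = k%:~R.
Proof. exact: (rmorph_int (comp_poly _)). Qed.

Lemma shift_stZ m c f : shift_s m (c *: f) = c *: shift_s m f.
Proof. exact: comp_polyZ. Qed.

Lemma shift_st_linear m : linear (shift_s m).
Proof. by move=> c f g; rewrite shift_stD shift_stZ. Qed.

Lemma shift_st_shift m n f : shift_s m (shift_s n f) = shift_s (m + n) f.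
Proof.
rewrite /shift_s -comp_polyA; congr (_ \Po _).
have -> : (var_s - n%:~R) \Po (var_s - m%:~R) = shift_s m (var_s + (- n)%:~R).
  by rewrite mulrNz.
by rewrite shift_stD shift_st_s shift_st_int; ring.
Qed.

End PolySt.

Arguments var_s {K}.
Arguments var_t {K}.

Section Phi.
Variables (K : numFieldType) (lambda : K) (lambda_neq0 : lambda != 0).
Variable h : {poly K}.

Definition Phi_basis_act (x : W00_index) (f : poly_st K) : poly_st K :=
  match x with
  | inl m => lambda ^ m *: ((var_s + m%:~R * poly_t h) * shift_s m f)
  | inr m => lambda ^ m *: (var_t * shift_s m f)
  end.

Definition Phi_act (u : W00 K) (f : poly_st K) : poly_st K :=
  linext (Phi_basis_act^~ f) u.

Lemma Phi_act_linearl f : linear (Phi_act^~ f).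
Proof. exact: linext_is_linear. Qed.

Lemma Phi_act_linearr u : linear (Phi_act u).
Proof.
apply: linear_linextP => -[] m c f g /=;
  by rewrite shift_st_linear !scale_stE; ring.
Qed.

Lemma Phi_actL m f :
  Phi_act (Lgen K m) f
    = lambda ^ m *: ((var_s + m%:~R * poly_t h) * shift_s m f).
Proof. by rewrite /Phi_act linextU. Qed.

Lemma Phi_actW m f :
  Phi_act (Wgen K m) f = lambda ^ m *: (var_t * shift_s m f).
Proof. by rewrite /Phi_act linextU. Qed.

Let actZ c u f : Phi_act (c *: u) f = c *: Phi_act u f.
Proof. by rewrite /Phi_act linearZ. Qed.

Let actN u f : Phi_act (- u) f = - Phi_act u f.
Proof. by rewrite /Phi_act linearN. Qed.

Let act0 f : Phi_act 0 f = 0.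
Proof. by rewrite /Phi_act linear0. Qed.

Lemma Phi_act_bracket (u v : W00 K) f :
  Phi_act (bracket u v) f = Phi_act u (Phi_act v f) - Phi_act v (Phi_act u f).
Proof.
rewrite -[bracket u v]/(W00_bracket u v).
have ll := W00_bracket_linearl; have lr := W00_bracket_linearr.
have al := Phi_act_linearl; have ar := Phi_act_linearr.
have subZ c (a b a' b' : poly_st K) :
    c *: a + a' - (c *: b + b') = c *: (a - b) + (a' - b').
  by rewrite !scale_stE; ring.
move: u; apply: malg_ext => [c a b|c a b|x]; first by rewrite ll al.
  by rewrite !(al, ar) subZ.
move: v; apply: malg_ext => [c a b|c a b|y]; first by rewrite lr al.
  by rewrite !(al, ar) subZ.
have E := (W00_bracketLL, W00_bracketLW, W00_bracketWL, W00_bracketWW).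
have cE (z : int) : poly_t z%:~R%:P = z%:~R :> poly_st K.
  by rewrite /poly_t !rmorph_int.
case: x y => m [] n; rewrite -?/(Lgen _ _) -?/(Wgen _ _) !E.
all: rewrite ?(actZ, actN, act0) !(Phi_actL, Phi_actW) !scale_stE ?cE.
all: rewrite !(shift_stM, shift_stD, shift_st_t, shift_st_s, shift_st_int,
  shift_st_shift).
all: rewrite ?(addrC n m) ?(expfzDr _ _ lambda_neq0).
all: ring.
Qed.

End Phi.

(* The action of W(0,0) does not involve alpha. *)
Definition Phi (K : numFieldType) (lambda : K) (lambda_neq0 : lambda != 0)
    (alpha : K) (h : {poly K}) : lieModule (W00 K) :=
  LieModule (Phi_act_linearl lambda h) (Phi_act_linearr lambda h)
    (Phi_act_bracket lambda_neq0 h).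

(* Main.v *)
(* Write D_k for the k-th divided derivative in s. For f in a submodule N, the
   elements lambda^(-m) W_m f and lambda^(-m) L_m f are polynomials in m, so a
   Vandermonde argument puts their coefficients in N: N is an ideal of C[s,t],
   and it contains t D_k f and s D_(k+1) f - h D_k f, hence also
   s D_(k+1) f - h(0) D_k f. If h(0) = 0 this gives s D_k f in N; otherwise,
   descending from D_k f = 0 for large k, it gives D_k f in N. Either way the
   top coefficient c of f satisfies s c in N, and so inductively N is
   determined by the ideals I_0 = {g | g in N} and I_1 = {g | s g in N} of
   C[t]. With I_1 = (g), the inclusions t I_1 <= I_0 <= I_1 (the first because
   t D_1 (s g) = t g) leave only I_0 = (g), where N = S_g, and I_0 = (t g),
   where N = S_(s g). *)
Require Import Defs.
From mathcomp Require Import all_boot all_order all_algebra.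
From mathcomp Require Import finmap monalg ring.
From mathcomp Require Import classical_sets boolp reals complex.

Set Implicit Arguments.
Unset Strict Implicit.
Unset Printing Implicit Defensive.

Import GRing.Theory Num.Theory.
Local Open Scope ring_scope.

(** * Extraction of coefficients and Taylor expansion in $s$ *)

(** The values at $m = 0, \dots, n-1$ suffice: their Vandermonde matrix is invertible in
    characteristic 0, and its inverse recovers each [v k] as a linear combination of them. *)
Lemma linear_closed_coef (K : numFieldType) (V : lmodType K) (N : set V)
    (N0 : N 0) (NP : forall (c : K) u v, N u -> N v -> N (c *: u + v))
    (n : nat) (v : nat -> V) :
  (forall m : nat, N (\sum_(k < n) m%:R ^+ k *: v k)) ->
  forall k, (k < n)%N -> N (v k).
Proof.
move=> Nv k kn.
pose A : 'M[K]_n := Vandermonde n (\row_j (j : nat)%:R).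
have Aunit : A \in unitmx.
  rewrite unitmxE unitfE det_Vandermonde.
  apply/prodf_neq0 => i _; apply/prodf_neq0 => j ij.
  by rewrite !mxE subr_eq0 eqr_nat gtn_eqF.
have -> : v k = \sum_(j < n) invmx A j (Ordinal kn)
    *: \sum_(i < n) (j : nat)%:R ^+ i *: v i.
  under eq_bigr do rewrite scaler_sumr.
  have AV (i : 'I_n) :
      \sum_(j < n) invmx A j (Ordinal kn) *: ((j : nat)%:R ^+ i *: v i)
        = (i == Ordinal kn)%:R *: v i.
    have /matrixP/(_ i (Ordinal kn)) := mulmxV Aunit.
    rewrite !mxE => <-; rewrite scaler_suml; apply: eq_bigr => j _.
    by rewrite scalerA !mxE mulrC.
  rewrite exchange_big /= (eq_bigr _ (fun i _ => AV i)) (bigD1 (Ordinal kn)) //=.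
  rewrite eqxx scale1r big1 ?addr0 // => i /negPf ->.
  by rewrite scale0r.
elim/big_ind : _ => // [x y Nx Ny|j _]; first by rewrite -[x]scale1r; exact: NP.
by rewrite -[_ *: _]addr0; exact: NP.
Qed.

Lemma nderivn_size_le (A : nzRingType) (p : {poly A}) (k : nat) :
  (size p <= k)%N -> p^`N(k) = 0.
Proof.
move=> pk; apply/polyP => i.
by rewrite coef_nderivn coef0 nth_default ?mul0rn ?(leq_trans pk) ?leq_addr.
Qed.

(** The shift by $-m$ is $f(s+m,t)$, whose expansion in powers of a natural number $m$ has no signs
    and fits [linear_closed_coef]. *)
Lemma shift_s_taylor (K : fieldType) (m : nat) (f : poly_st K) :
  shift_s (- m%:Z) f
    = \sum_(k < size f) m%:R ^+ k *: ((f : {poly {poly K}})^`N(k) : poly_st K).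
Proof.
rewrite /shift_s /comp_poly (_ : var_s - (- m%:Z)%:~R = 'X + m%:R); last first.
  by rewrite mulrNz opprK.
rewrite nderiv_taylor; last exact: mulrC.
rewrite size_map_polyC; apply: eq_bigr => k _.
rewrite scale_stE /poly_t !rmorphXn /= !rmorph_nat mulrC nderivn_map.
by rewrite [_.['X]]comp_polyXr.
Qed.

Lemma shift_s0 (K : fieldType) (f : poly_st K) : shift_s 0 f = f.
Proof. by rewrite /shift_s subr0; exact: comp_polyXr. Qed.

(** * Closure properties of a submodule *)

Section PhiSubmodule.
Variables (K : numFieldType) (lambda : K) (lambda_neq0 : lambda != 0).
Variables (alpha : K) (h : {poly K}) (N : set (poly_st K)).
Hypothesis subN : submodule (V := Phi lambda_neq0 alpha h) N.
Implicit Types (f p : poly_st K) (q : {poly K}).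
Local Notation "f ^`NN( k )" := ((f : {poly {poly K}})^`N(k) : poly_st K)
  (at level 1, format "f ^`NN( k )").

Lemma submodule0 : N 0.
Proof. by case: subN. Qed.

Lemma submoduleZD (c : K) f p : N f -> N p -> N (c *: f + p).
Proof. by case: subN => _ + _; apply. Qed.

Lemma submoduleD f p : N f -> N p -> N (f + p).
Proof. by rewrite -[f in N (f + p)]scale1r; exact: submoduleZD. Qed.

Lemma submoduleZ (c : K) f : N f -> N (c *: f).
Proof.
move=> Nf; rewrite -[_ *: _]addr0; apply: submoduleZD => //.
exact: submodule0.
Qed.

Lemma submoduleN f : N f -> N (- f).
Proof. by rewrite -scaleN1r; exact: submoduleZ. Qed.

Lemma submoduleW (m : int) f : N f -> N (var_t * shift_s m f).
Proof.
case: subN => _ _ actN Nf.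
have := submoduleZ (lambda ^ m)^-1 (actN (Wgen K m) f Nf).
rewrite [act _ _]Phi_actW scalerA mulVf ?scale1r //.
exact: expfz_neq0.
Qed.

Lemma submoduleL (m : int) f :
  N f -> N ((var_s + m%:~R * poly_t h) * shift_s m f).
Proof.
case: subN => _ _ actN Nf.
have := submoduleZ (lambda ^ m)^-1 (actN (Lgen K m) f Nf).
rewrite [act _ _]Phi_actL scalerA mulVf ?scale1r //.
exact: expfz_neq0.
Qed.

(** $L_0$ acts as multiplication by $s$. *)
Lemma submoduleMs f : N f -> N (var_s * f).
Proof. by move=> /(submoduleL 0); rewrite mul0r addr0 shift_s0. Qed.

(** $W_0$ acts as multiplication by $t$; Horner induction on [q] does the rest. *)
Lemma submoduleMt q f : N f -> N (poly_t q * f).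
Proof.
move=> Nf; elim/poly_ind: q => [|q c IH].
  by rewrite /poly_t mul0r; exact: submodule0.
have -> : poly_t (q * 'X + c%:P) * f = c *: f + var_t * (poly_t q * f).
  rewrite scale_stE.
  have -> : poly_t (q * 'X + c%:P) = poly_t q * var_t + poly_t c%:P.
    by rewrite /poly_t polyCD polyCM.
  ring.
by apply: submoduleZD => //; have := submoduleW 0 IH; rewrite shift_s0.
Qed.

Lemma submoduleM p f : N f -> N (p * f).
Proof.
move=> Nf; elim/poly_ind: p => [|p c IH].
  by rewrite mul0r; exact: submodule0.
have -> : (p * 'X + c%:P : poly_st K) * f = var_s * (p * f) + poly_t c * f.
  by rewrite /var_s /poly_t; ring.
by apply: submoduleD; [exact: submoduleMs|exact: submoduleMt].
Qed.

(** This is the coefficient of $m^k$ in $\lambda^m W_{-m} f = t f(s+m,t)$. *)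
Lemma submodule_t_nderivn f k : N f -> N (var_t * f^`NN(k)).
Proof.
move=> Nf; have [kf|kf] := leqP (size f) k.
  by rewrite nderivn_size_le // mulr0; exact: submodule0.
apply: (@linear_closed_coef K (poly_st K) N submodule0 submoduleZD (size f)
  (fun k => var_t * f^`NN(k))) => // m.
have := submoduleW (- m%:Z) Nf; rewrite shift_s_taylor mulr_sumr.
congr N; apply: eq_bigr => i _; rewrite !scale_stE; ring.
Qed.

Lemma submodule_s_nderivnS f k :
  N f -> N (var_s * f^`NN(k.+1) - poly_t h * f^`NN(k)).
Proof.
move=> Nf; have [kf|kf] := leqP (size f) k.
  by rewrite !nderivn_size_le ?(leqW kf) // !mulr0 subr0; exact: submodule0.
(* [v j] is the coefficient of $m^j$ in $(s - mh) f(s+m,t)$. The factor $mh$ raises the degree in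
   $m$ by one, hence [(size f).+1] coefficients, and [v 0] has no term in $h$. *)
pose v j : poly_st K :=
  var_s * f^`NN(j) - (if j is i.+1 then poly_t h * f^`NN(i) else 0).
apply: (@linear_closed_coef K (poly_st K) N submodule0 submoduleZD (size f).+1
  v _ k.+1) => // m.
have := submoduleL (- m%:Z) Nf; rewrite shift_s_taylor.
congr N; transitivity
  (\sum_(i < (size f).+1) m%:R ^+ i *: (var_s * f^`NN(i))
   - \sum_(i < (size f).+1)
       m%:R ^+ i *: (if nat_of_ord i is j.+1 then poly_t h * f^`NN(j) else 0));
  last first.
  by rewrite -sumrB; apply: eq_bigr => i _; rewrite /v scalerBr.
rewrite big_ord_recr big_ord_recl /= nderivn_size_le // mulr0 !scaler0 addr0 add0r.
rewrite mulrDl !mulr_sumr -sumrN -!big_split /=; apply: eq_bigr => i _.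
rewrite !scale_stE /poly_t !rmorphXn /= !rmorph_nat /bump /= add1n exprS mulrNz.
ring.
Qed.

Lemma submodule_s_nderivn f k : N f -> N (var_s * f^`NN(k)).
Proof.
move=> Nf.
pose c := h.[0].
(* Writing $h = c + t h_1$, the part $t h_1 D_j f$ already lies in [N], so $h$ may be replaced by $c
   = h(0)$. *)
have Nstep j : N (var_s * f^`NN(j.+1) - c *: f^`NN(j)).
  have [h1 hE] : exists h1, h - c%:P = h1 * ('X - 0%:P).
    by apply/factor_theorem; rewrite /root !hornerE subrr.
  have := submoduleD (submodule_s_nderivnS j Nf)
    (submoduleMt h1 (submodule_t_nderivn j Nf)).
  have -> : poly_t h = poly_t h1 * var_t + poly_t c%:P.
    rewrite /poly_t /var_t -polyCM -polyCD; congr polyC.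
    by move: hE; rewrite subr0 => <-; rewrite subrK.
  by congr N; rewrite scale_stE; ring.
have [c0|c0] := eqVneq c 0.
  case: k => [|k]; first by rewrite nderivn0; exact: submoduleMs.
  by have := Nstep k; rewrite c0 scale0r subr0.
apply: submoduleMs.
(* Descending induction on the order of the derivative, solving [Nstep] for $D_k f$ by division by
   $c$. *)
have Nd j : N f^`NN(size f - j).
  elim: j => [|j IH].
    by rewrite subn0 nderivn_size_le //; exact: submodule0.
  (* Once [size f <= j], truncated subtraction stays at 0 and the induction hypothesis is already
     the claim. *)
  have [jf|jf] := leqP (size f) j.
    have /eqP jf0 : (size f - j == 0)%N by rewrite subn_eq0.
    by rewrite subnS jf0 /= -jf0.
  have := submoduleZ c^-1 (submoduleD (submoduleMs IH)
    (submoduleN (Nstep (size f - j.+1)%N))).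
  by rewrite -subnSK // opprB addrC addrNK scalerA mulVf // scale1r.
have [kf|kf] := leqP (size f) k.
  by rewrite nderivn_size_le //; exact: submodule0.
by rewrite -(subKn (ltnW kf)).
Qed.

Lemma submoduleP f :
  N f <-> N (poly_t f`_0) /\ forall i, N (var_s * poly_t f`_i).
Proof.
split=> [|[f0 fi]]; last first.
  have -> : f = \sum_(i < size f) var_s ^+ i * poly_t f`_i.
    rewrite -[LHS]coefK poly_def; apply: eq_bigr => i _.
    by rewrite -mul_polyC mulrC.
  elim/big_ind : _ => [||i _]; [exact: submodule0|exact: submoduleD|].
  case: i => -[|i] _ /=; first by rewrite expr0 mul1r.
  by rewrite exprSr -mulrA; exact: submoduleM.
have [n] := ubnP (size f); elim: n f => // n IH f; rewrite ltnS => fn Nf.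
case: n => [|n] in IH fn *.
  have -> : f = 0 by apply/eqP; rewrite -size_poly_leq0.
  rewrite coef0; split; first exact: submodule0.
  by move=> i; rewrite coef0 /poly_t mulr0; exact: submodule0.
(* As [size f <= n.+1], the derivative $D_n f$ is just the coefficient of $s^n$. *)
have Nsn : N (var_s * poly_t f`_n).
  have := submodule_s_nderivn n Nf; congr (N (_ * _)).
  apply/polyP => i; rewrite coef_nderivn coefC.
  case: i => [|i]; first by rewrite addn0 binn.
  by rewrite nth_default ?mul0rn // (leq_trans fn) // addnS ltnS leq_addr.
(* A constant in $s$ is its own coefficient of $s^0$. In higher degree the top term is a multiple of
   $s f_{n+1}$, so it lies in [N] and can be subtracted without touching $f_0$. *)
case: n => [|n] in IH fn Nsn *.
  have fE : f = poly_t f`_0 by exact: size1_polyC.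
  split; first by rewrite -fE.
  case=> // i; rewrite nth_default ?(leq_trans fn) // /poly_t mulr0.
  exact: submodule0.
pose g : poly_st K := f - var_s ^+ n * (var_s * poly_t f`_n.+1).
have gE i : g`_i = if i == n.+1 then 0 else f`_i.
  rewrite /g mulrA -exprSr coefB coefMC coefXn.
  by have [->|] := eqVneq i n.+1; rewrite ?mul1r ?subrr ?mul0r ?subr0.
have [||g0 gi] := IH g.
- rewrite ltnS; apply/leq_sizeP => i ni; rewrite gE; case: eqVneq => // i_n.
  by rewrite nth_default // (leq_trans fn) // ltn_neqAle eq_sym i_n.
- by apply: submoduleD => //; apply: submoduleN; exact: submoduleM.
split; first by move: g0; rewrite gE.
by move=> i; have := gi i; rewrite gE; case: eqVneq => [->|].
Qed.

End PhiSubmodule.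

(** * Classification of the submodules by ideals of $K[t]$ *)

(** A nonzero element of least size divides all others, since a nonzero remainder would be smaller;
    the zero ideal takes [g = 0]. *)
Lemma poly_ideal_principal (K : fieldType) (I : set {poly K}) :
  I 0 -> (forall p q, I p -> I q -> I (p + q)) ->
  (forall p q, I q -> I (p * q)) ->
  exists2 g, I g & forall q, I q -> g %| q.
Proof.
move=> I0 ID IM.
have [[q [Iq q0]]|I_eq0] := pselect (exists q, I q /\ q != 0); last first.
  exists 0 => // q Iq; rewrite dvd0p; apply/negPn/negP => q0.
  by apply: I_eq0; exists q.
pose P n := `[< exists q, [/\ I q, q != 0 & size q = n] >].
have exP : exists n, P n by exists (size q); apply/asboolP; exists q.
have [n /asboolP[g [Ig g0 <-]] gmin] := ex_minnP exP.
exists g => // p Ip; apply/negPn/negP; rewrite /dvdp => pg0.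
have /gmin : P (size (p %% g)).
  apply/asboolP; exists (p %% g); split => //.
  have -> : p %% g = p + - (p %/ g) * g by rewrite {2}(divp_eq p g); ring.
  by apply: ID => //; exact: IM.
by rewrite leqNgt ltn_modp g0.
Qed.

Lemma Phi_submodule_generated (K : numFieldType) (lambda : K)
    (lambda_neq0 : lambda != 0) (alpha : K) (h : {poly K})
    (N : set (Phi lambda_neq0 alpha h)) :
  submodule N ->
  exists f : {poly K},
    N = generated (V := Phi lambda_neq0 alpha h) (var_s * poly_t f) \/
    N = generated (V := Phi lambda_neq0 alpha h) (poly_t f).
Proof.
move=> subN.
have polytM p q : poly_t (p * q) = poly_t p * poly_t q :> poly_st K.
  exact: polyCM.
(* It suffices to show that every submodule containing the generator [v] contains [N]; [submoduleP]
   then reduces this to coefficients. *)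
have NE (v : Phi lambda_neq0 alpha h) : N v ->
    (forall M : set (Phi lambda_neq0 alpha h), submodule M -> M v ->
      forall f : poly_st K, N f -> M f) ->
    N = generated v.
  move=> Nv NM; apply/seteqP; split=> [f Nf M [subM vM]|f].
    by apply: NM => //; exact: vM.
  by apply; split => // _ ->.
have [g Ng gP] : exists2 g, N (var_s * poly_t g) &
    forall q, N (var_s * poly_t q) -> g %| q.
  apply: (@poly_ideal_principal _ (fun q => N (var_s * poly_t q))).
  - by rewrite /poly_t mulr0; exact: (submodule0 subN).
  - move=> p q Np Nq; rewrite /poly_t polyCD mulrDr.
    exact: (submoduleD subN Np Nq).
  - by move=> p q Nq; rewrite polytM mulrCA; exact: (submoduleM subN).
have coefN (f : poly_st K) : N f -> forall i, g %| f`_i.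
  by move=> Nf i; apply: gP; have [] := (submoduleP subN f).1 Nf.
exists g; have [N0|N0] := pselect (N (poly_t g)); [right|left].
  apply: NE => // M subM Mg f /coefN gf; apply: (submoduleP subM f).2.
  split=> [|i]; rewrite -(divpK (gf _)) polytM; first exact: (submoduleM subM).
  by rewrite mulrA; exact: (submoduleM subM).
apply: NE => // M subM Msg f Nf; apply: (submoduleP subM f).2.
split=> [|i]; last first.
  by rewrite -(divpK (coefN f Nf i)) polytM mulrCA; exact: (submoduleM subM).
(* $t g = t D_1(s g)$. *)
have tM (L : set (Phi lambda_neq0 alpha h)) :
    submodule L -> L (var_s * poly_t g) -> L (var_t * poly_t g).
  move=> subL /(submodule_t_nderivn subL 1); congr (L (_ * _)).
  by rewrite nderivn1 /var_s /poly_t mulrC mul_polyC derivZ derivX alg_polyC.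
(* With $r = c + t r_1$, one has $f_0 = c g + r_1 t g$. If $c \neq 0$, then $g$ would lie in [N],
   against [N0]; so $f_0$ is a multiple of $t g$, which lies in [M]. *)
pose r := f`_0 %/ g; pose c := r.[0].
have [r1 rE] : exists r1, r - c%:P = r1 * ('X - 0%:P).
  by apply/factor_theorem; rewrite /root !hornerE subrr.
have f0E : poly_t f`_0
    = c *: (poly_t g : poly_st K) + poly_t r1 * (var_t * poly_t g).
  rewrite -(divpK (coefN f Nf 0)) -/r -[r](subrK c%:P) rE subr0 scale_stE.
  by rewrite /poly_t /var_t !(polyCD, polyCM); ring.
suff c0 : c = 0.
  rewrite f0E c0 scale0r add0r.
  by apply: (submoduleM subM); exact: tM.
apply/eqP/negPn/negP => c0; apply: N0.
have [Nf0 _] := (submoduleP subN f).1 Nf.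
have -> : poly_t g
    = c^-1 *: (poly_t f`_0 - poly_t r1 * (var_t * poly_t g)) :> poly_st K.
  by rewrite f0E addrK scalerA mulVf // scale1r.
apply: (submoduleZ subN); apply: (submoduleD subN) => //.
by apply: (submoduleN subN); apply: (submoduleM subN); exact: tM.
Qed.

Theorem theorem2p3 (R : realType) (lambda : R[i]) (lambda_neq0 : lambda != 0)
    (alpha : R[i]) (h : {poly R[i]}) :
  let V := Phi lambda_neq0 alpha h in
  (forall N : set V, submodule N <->
     exists f : {poly R[i]},
       N = generated (V := V) (var_s * poly_t f) \/
       N = generated (V := V) (poly_t f)) /\
  (forall N : set V, submodule N -> cyclic_submodule N).
Proof.
move=> V.
have genN (N : set V) (subN : submodule N) :=
  @Phi_submodule_generated _ _ lambda_neq0 alpha h N subN.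
split=> [N|N /genN[f [->|->]]].
- by split=> [/genN //|[f [->|->]]]; exact: generatedP.
- by exists (var_s * poly_t f).
- by exists (poly_t f).
Qed.
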